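(* Let $q$ be a prime power and let $n$ be an integer with $n\geq 5$, or $n=4$ and $q\in\{2,3\}$. Let $\alpha\in\mathbb{F}_{q^n}^*$ and let $a,b\in\mathbb{F}_q$. Then there exist $x,y\in\mathbb{F}_{q^n}$ with $\mathrm{Tr}(x)=a$, $\mathrm{Tr}(y)=b$ and $\alpha=x\cdot y$.
   Context: $\mathrm{Tr}$ denotes the field trace $\mathrm{Tr}_{\mathbb{F}_{q^n}/\mathbb{F}_q}(x)=x+x^q+\cdots+x^{q^{n-1}}$. *)

(* Defs.v *)
From HB Require Import structures.
From mathcomp Require Import all_boot all_order all_algebra all_field.

Set Implicit Arguments.
Unset Strict Implicit.
Unset Printing Implicit Defensive.

Import GRing.Theory.
Local Open Scope ring_scope.

(* Trace of L over the finite field F, written as the explicit sum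
   x + x^q + ... + x^(q^(n-1)) with q = #|F| and n = [L : F].
   It takes values in L; elements a of F are embedded in L as a%:A. *)
Definition field_trace (F : finFieldType) (L : fieldExtType F) (x : L) : L :=
  \sum_(i < \dim {:L}) x ^+ (#|F| ^ i).

(* Main.v *)
Require Import Defs.
From HB Require Import structures.
From mathcomp Require Import all_boot all_order all_algebra all_field.
From mathcomp Require Import pgroup abelian zify ring.

(** Write [Q = q ^ n].  The map [u |-> 1 - u ^ (q - 1)] is the indicator of [0]
    on [F_q], so it suffices to find an exponent [K] for which
      [T = sum_{x != 0} x ^ K (1 - (Tr x - a) ^ (q-1)) (1 - (Tr (alpha/x) - b) ^ (q-1))]
    is nonzero in [L].  Expanding both powers gives monomials [x ^ D] with
    [D = sum_i (k_i - l_i) q ^ i], where [k] and [l] have weight at most [q - 1],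
    and [sum_{x != 0} x ^ (K + D)] vanishes unless [Q - 1] divides [K + D].
    Take [-K = sum_i (A_i - B_i) q ^ i] with [A] and [B] of weight [q - 1] each.
    If [k - l] is the only such signed digit vector congruent to [A - B], then [T]
    is, up to sign and a power of [alpha], a product of two multinomial
    coefficients; with two nonzero digits these are [binom (q-1) j = (-1) ^ j]
    in [L].  The digits [A = (h, 0, h', 0, 0, ...)], [B = (0, h, 0, h', 0, ...)]
    with [h = floor ((q-1)/2)], [h' = q - 1 - h] work for [q >= 3], [n >= 5] and
    for [q = 3], [n = 4]; for [q = 2] the digits [A = e_0], [B = e_2] work.
    Uniqueness is a carry argument: congruent digit vectors differ by
    [q c_{i+1} - c_i] for a cyclic integer sequence [c] of carries, and the weight
    bounds force [c = 0]. *)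

Set Implicit Arguments.
Unset Strict Implicit.
Unset Printing Implicit Defensive.

Import Order.TTheory GRing.Theory Num.Theory.
Local Open Scope ring_scope.

Lemma carries (q : nat) (t' : int) (n : nat) : forall (t : int) (w : nat -> int),
  \sum_(i < n) w i * q%:Z ^+ i = t' * q%:Z ^+ n - t ->
  exists c : nat -> int, [/\ c 0%N = t, c n = t' &
    forall i, (i < n)%N -> w i = q%:Z * c i.+1 - c i].
Proof.
elim: n => [|n IHn] t w.
  rewrite big_ord0 expr0 mulr1 => /eqP; rewrite eq_sym subr_eq0 => /eqP <-.
  by exists (fun=> t').
rewrite big_ord_recl expr0 mulr1 exprS => sum_w.
set s := t' * q%:Z ^+ n - \sum_(i < n) w i.+1 * q%:Z ^+ i.
have sumS : \sum_(i < n) w (lift ord0 i) * q%:Z ^+ lift ord0 i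
    = q%:Z * \sum_(i < n) w i.+1 * q%:Z ^+ i.
  rewrite mulr_sumr; apply: eq_bigr => i _.
  by rewrite lift0 exprS mulrCA.
have [|c [c0 cn cS]] := IHn s (fun i => w i.+1); first by rewrite /s; ring.
exists (fun i => if i is j.+1 then c j else t); split=> // -[_|i]; last exact: cS.
rewrite c0 /s; move: sum_w; rewrite sumS /= => sum_w.
apply: (addIr (q%:Z * \sum_(i < n) w i.+1 * q%:Z ^+ i)); rewrite sum_w; ring.
Qed.

Definition pos_part (c : int) : int := Num.max c 0.

Lemma pos_part_carry (q : nat) (c c' : int) (k : nat) :
  q%:Z * c' - c <= k%:Z -> q%:Z * pos_part c' - pos_part c <= k%:Z.
Proof. rewrite /pos_part; have [] := lerP c' 0; have [] := lerP c 0; nia. Qed.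

Lemma sum_digits_ge_carries (q n : nat) (c : nat -> int) (k : nat -> nat) : (0 < q)%N ->
  (forall i, (4 <= i < 5 + n)%N -> q%:Z * c i.+1 - c i <= (k i)%:Z) ->
  q%:Z * pos_part (c (5 + n)%N) - pos_part (c 4%N)
    <= (\sum_(4 <= i < 5 + n) k i)%N%:Z.
Proof.
move=> q_gt0; elim: n => [|n IHn] kP.
  by rewrite big_nat1; apply: pos_part_carry; apply: kP.
rewrite addnS big_nat_recr //=.
have/pos_part_carry := kP (5 + n)%N ltac:(lia).
have {IHn} := IHn (fun i hi => kP i ltac:(lia)).
have : 0 <= pos_part (c (5 + n)%N) by rewrite /pos_part; lia.
move: (pos_part _) (pos_part _) (pos_part _) (bigop _ _ _) => x y z u; rewrite PoszD.
nia.
Qed.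

(* The weight bounds leave at most 2 for the sum of the positive parts of the
   carries, and likewise for the negative parts; the finitely many cases left are
   linear in [q]. *)
Lemma head_carries (q h : nat) (c0 c1 c2 c3 c4 : int) (k0 k1 k2 k3 l0 l1 l2 l3 : nat) :
  (3 <= q)%N -> h = (q.-1)./2 ->
  k0%:Z - l0%:Z - h%:Z = q%:Z * c1 - c0 ->
  k1%:Z - l1%:Z + h%:Z = q%:Z * c2 - c1 ->
  k2%:Z - l2%:Z - (q.-1 - h)%N%:Z = q%:Z * c3 - c2 ->
  k3%:Z - l3%:Z + (q.-1 - h)%N%:Z = q%:Z * c4 - c3 ->
  (k0 + k1 + k2 + k3 <= q.-1)%N -> (l0 + l1 + l2 + l3 <= q.-1)%N ->
  (k0 + k1 + k2 + k3)%N%:Z + q%:Z * pos_part c0 - pos_part c4 <= q.-1%:Z ->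
  (l0 + l1 + l2 + l3)%N%:Z + q%:Z * pos_part (- c0) - pos_part (- c4) <= q.-1%:Z ->
  [/\ c0 = 0, c1 = 0, c2 = 0, c3 = 0 & c4 = 0].
Proof.
move=> q_ge3 def_h E0 E1 E2 E3 hk' hl' hk hl.
have pc c c' d e : d%:Z - e%:Z = q%:Z * c' - c ->
    q%:Z * pos_part c' - pos_part c <= d%:Z /\ q%:Z * pos_part (- c') - pos_part (- c) <= e%:Z.
  by move=> E; split; apply: pos_part_carry; lia.
have [P0 N0] := pc c0 c1 k0 (l0 + h)%N ltac:(lia).
have [P1 N1] := pc c1 c2 (k1 + h)%N l1 ltac:(lia).
have [P2 N2] := pc c2 c3 k2 (l2 + (q.-1 - h))%N ltac:(lia).
have [P3 N3] := pc c3 c4 (k3 + (q.-1 - h))%N l3 ltac:(lia).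
have pos_partE c : [/\ 0 <= pos_part c, 0 <= pos_part (- c), c = pos_part c - pos_part (- c) & pos_part c = 0 \/ pos_part (- c) = 0].
  by rewrite /pos_part; split; lia.
move: (pos_partE c0) (pos_partE c1) (pos_partE c2) (pos_partE c3) (pos_partE c4) => {pos_partE pc}.
move: (pos_part c0) (pos_part c1) (pos_part c2) (pos_part c3) (pos_part c4)
  (pos_part (- c0)) (pos_part (- c1)) (pos_part (- c2)) (pos_part (- c3)) (pos_part (- c4))
  P0 P1 P2 P3 N0 N1 N2 N3 hk hl => p0 p1 p2 p3 p4 n0 n1 n2 n3 n4.
move=> P0 P1 P2 P3 N0 N1 N2 N3 hk hl.
move=> [p0p n0p e0 d0] [p1p n1p e1 d1] [p2p n2p e2 d2] [p3p n3p e3 d3] [p4p n4p e4 d4].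
have [m Em] : exists m, q = m.+1 by exists q.-1; lia.
move: Em q_ge3 def_h E0 E1 E2 E3 P0 P1 P2 P3 N0 N1 N2 N3 hk' hl' hk hl => -> /= {q} m_ge2 def_h.
rewrite -addn1 PoszD.
have [hm hm'] : (h <= m - h)%N /\ (m - h <= h.+1)%N by lia.
have h_gt0 : (0 < h)%N by lia.
move=> E0 E1 E2 E3 P0 P1 P2 P3 N0 N1 N2 N3 hk' hl' hk hl.
have SP : p0 + p1 + p2 + p3 + p4 <= 2.
  have : m%:Z * (p0 + p1 + p2 + p3 + p4) <= m%:Z * 2 by lia.
  by rewrite ler_pM2l //; lia.
have SN : n0 + n1 + n2 + n3 + n4 <= 2.
  have : m%:Z * (n0 + n1 + n2 + n3 + n4) <= m%:Z * 2 by lia.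
  by rewrite ler_pM2l //; lia.
clear P0 P1 P2 P3 N0 N1 N2 N3 def_h.
have enum (c p n : int) : 0 <= p -> 0 <= n -> c = p - n -> p = 0 \/ n = 0 -> p <= 2 -> n <= 2 ->
  [\/ [/\ c = 0, p = 0 & n = 0], [/\ c = 1, p = 1 & n = 0], [/\ c = 2, p = 2 & n = 0]
    | [/\ c = -1, p = 0 & n = 1]] \/ [/\ c = -2, p = 0 & n = 2].
  move=> p_ge0 n_ge0 -> [] -> hp hn.
    have [->|[->|->]] : n = 0 \/ n = 1 \/ n = 2 by lia.
    - by left; apply: Or41; split; lia.
    - by left; apply: Or44; split; lia.
    - by right; split; lia.
  have [->|[->|->]] : p = 0 \/ p = 1 \/ p = 2 by lia.
  - by left; apply: Or41; split; lia.
  - by left; apply: Or42; split; lia.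
  - by left; apply: Or43; split; lia.
have := enum _ _ _ p4p n4p e4 d4 ltac:(lia) ltac:(lia).
have := enum _ _ _ p3p n3p e3 d3 ltac:(lia) ltac:(lia).
have := enum _ _ _ p2p n2p e2 d2 ltac:(lia) ltac:(lia).
have := enum _ _ _ p1p n1p e1 d1 ltac:(lia) ltac:(lia).
have := enum _ _ _ p0p n0p e0 d0 ltac:(lia) ltac:(lia).
clear enum e0 e1 e2 e3 e4 d0 d1 d2 d3 d4.
do 5 (case=> [[]|] [? ? ?]; subst; try (exfalso; lia)).
by split.
Qed.

Lemma carries_mod (q n : nat) (A B k l : nat -> nat) : (1 < q)%N -> (0 < n)%N ->
  (\sum_(i < n) k i * q ^ i + \sum_(i < n) B i * q ^ i
   = \sum_(i < n) A i * q ^ i + \sum_(i < n) l i * q ^ i %[mod (q ^ n).-1])%N ->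
  exists c : nat -> int, c n = c 0%N /\ forall i, (i < n)%N ->
    (k i)%:Z - (l i)%:Z - ((A i)%:Z - (B i)%:Z) = q%:Z * c i.+1 - c i.
Proof.
move=> q_gt1 n_gt0; set X := (_ + _)%N; set Y := (_ + _)%N => eq_mod.
have [t Et] : exists t : int, X%:Z - Y%:Z = t * ((q ^ n).-1)%:Z.
  exists ((X %/ (q ^ n).-1)%N%:Z - (Y %/ (q ^ n).-1)%N%:Z).
  by rewrite {1}(divn_eq X (q ^ n).-1) {1}(divn_eq Y (q ^ n).-1) eq_mod; lia.
have sumZ (f : nat -> nat) : (\sum_(i < n) f i * q ^ i)%N%:Z = \sum_(i < n) (f i)%:Z * q%:Z ^+ i.
  by rewrite -natz natr_sum; apply: eq_bigr => i _; rewrite natrM natrX !natz.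
have [|c [c0 cn cS]] := @carries q t n t (fun i => (k i)%:Z - (l i)%:Z - ((A i)%:Z - (B i)%:Z)).
  have q_gt0 : (0 < q ^ n)%N by rewrite expn_gt0; lia.
  have -> : t * q%:Z ^+ n - t = X%:Z - Y%:Z.
    by rewrite Et -subn1 -subzn // -[X in X - 1]natz natrX natz; ring.
  rewrite /X /Y !PoszD !sumZ -!big_split -sumrB; apply: eq_bigr => i _ /=; ring.
by exists c; rewrite c0 cn.
Qed.

Definition isolated (q n : nat) (A B : nat -> nat) := forall k l : nat -> nat,
  (\sum_(i < n) k i <= q.-1)%N -> (\sum_(i < n) l i <= q.-1)%N ->
  (\sum_(i < n) k i * q ^ i + \sum_(i < n) B i * q ^ i
   = \sum_(i < n) A i * q ^ i + \sum_(i < n) l i * q ^ i %[mod (q ^ n).-1])%N ->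
  forall i, (i < n)%N -> k i = A i /\ l i = B i.

Definition digits2 (r s u v i : nat) : nat := (if i == r then u else 0) + (if i == s then v else 0).

Lemma eq_digits (n : nat) (A k : nat -> nat) : (\sum_(i < n) k i <= \sum_(i < n) A i)%N ->
  (forall i, (i < n)%N -> A i <= k i)%N -> forall i, (i < n)%N -> k i = A i.
Proof.
move=> le_kA le_Ak i i_lt; apply/eqP; rewrite eq_sym.
have [le_AK] := leqif_sum (fun (j : 'I_n) (_ : true) => leqif_eq (le_Ak j (ltn_ord j))).
by rewrite eqn_leq le_AK le_kA => /esym/forallP/(_ (Ordinal i_lt)).
Qed.

Lemma sum_digits2 (n r s u v : nat) : (r < n)%N -> (s < n)%N ->
  (\sum_(i < n) digits2 r s u v i = u + v)%N.
Proof.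
move=> r_lt s_lt; rewrite big_split /= -!big_mkcond /=.
by rewrite (big_pred1 (Ordinal r_lt)) // (big_pred1 (Ordinal s_lt)).
Qed.

(* Beyond position 3, where [A] and [B] vanish, the carries enter only through
   [c 0] and [c 4]. *)
Lemma isolated_head (q n : nat) (A B : nat -> nat) : (1 < q)%N -> (3 < n)%N ->
  (\sum_(i < n) A i = q.-1)%N -> (\sum_(i < n) B i = q.-1)%N ->
  (forall i, 3 < i -> A i = 0 /\ B i = 0)%N ->
  (forall (c : nat -> int) (k l : nat -> nat),
    (forall i, (i < 4)%N ->
      (k i)%:Z - (l i)%:Z - ((A i)%:Z - (B i)%:Z) = q%:Z * c i.+1 - c i) ->
    (k 0 + k 1 + k 2 + k 3 <= q.-1)%N -> (l 0 + l 1 + l 2 + l 3 <= q.-1)%N ->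
    n = 4%N /\ c 4%N = c 0%N \/ (4 < n)%N /\
      [/\ (k 0 + k 1 + k 2 + k 3)%N%:Z + q%:Z * pos_part (c 0%N) - pos_part (c 4%N) <= q.-1%:Z
         & (l 0 + l 1 + l 2 + l 3)%N%:Z + q%:Z * pos_part (- c 0%N) - pos_part (- c 4%N) <= q.-1%:Z] ->
    forall i, (i < 4)%N -> (A i <= k i)%N /\ (B i <= l i)%N) ->
  isolated q n A B.
Proof.
move=> q_gt1 n_gt3 sumA sumB AB0 head k l sum_k sum_l eq_mod.
have [c [cn cS]] := carries_mod q_gt1 (ltn_trans (isT : (0 < 3)%N) n_gt3) eq_mod.
have split_sum (f : nat -> nat) :
    (\sum_(i < n) f i = f 0 + f 1 + f 2 + f 3 + \sum_(4 <= i < n) f i)%N.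
  rewrite -(big_mkord xpredT f) (@big_cat_nat _ _ _ 4) //=.
  by rewrite !big_nat_recr //= big_geq.
have le_AB : forall i, (i < 4)%N -> (A i <= k i)%N /\ (B i <= l i)%N.
  move: sum_k sum_l; rewrite !split_sum => sum_k sum_l.
  apply: (head c) => [i i_lt||| ]; [by apply: cS; lia | lia | lia |].
  have [n4|n_gt4] : n = 4%N \/ (4 < n)%N by lia.
    by left; rewrite -[in c _]n4.
  right; split=> //.
  have En : n = (5 + (n - 5))%N by lia.
  have k_tail : q%:Z * pos_part (c 0%N) - pos_part (c 4%N) <= (\sum_(4 <= i < n) k i)%N%:Z.
    rewrite -cn En; apply: sum_digits_ge_carries; first lia.
    by move=> i i_lt; have := @cS i ltac:(lia); have [-> ->] := @AB0 i ltac:(lia); lia.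
  have l_tail : q%:Z * pos_part (- c 0%N) - pos_part (- c 4%N) <= (\sum_(4 <= i < n) l i)%N%:Z.
    rewrite -cn En; apply: (sum_digits_ge_carries (c := fun i => - c i)); first lia.
    by move=> i i_lt; have := @cS i ltac:(lia); have [-> ->] := @AB0 i ltac:(lia); lia.
  by split; lia.
have le_ABn i : (i < n)%N -> (A i <= k i)%N /\ (B i <= l i)%N.
  by have [/le_AB|/AB0[-> ->]] := ltnP i 4.
move=> i i_lt; split; apply: (@eq_digits n) i_lt; rewrite ?sumA ?sumB //.
  by move=> j /le_ABn[].
by move=> j /le_ABn[].
Qed.

Lemma isolated_ge5 (q n : nat) : (2 < q)%N -> (4 < n)%N ->
  isolated q n (digits2 0 2 (q.-1)./2 (q.-1 - (q.-1)./2))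
               (digits2 1 3 (q.-1)./2 (q.-1 - (q.-1)./2)).
Proof.
move=> q_gt2 n_gt4; apply: isolated_head; try lia.
- by rewrite sum_digits2; lia.
- by rewrite sum_digits2; lia.
- by move=> [|[|[|[|i]]]].
move=> c k l cS sk sl [|[_ [hk hl]]]; first lia.
have := cS 0%N isT; have := cS 1%N isT; have := cS 2%N isT; have := cS 3%N isT.
rewrite /digits2 /= !addn0 !add0n => E3 E2 E1 E0.
have [||||c0 c1 c2 c3 c4] := @head_carries q _ (c 0%N) (c 1%N) (c 2%N) (c 3%N) (c 4%N)
  (k 0%N) (k 1%N) (k 2%N) (k 3%N) (l 0%N) (l 1%N) (l 2%N) (l 3%N) q_gt2 erefl _ _ _ _ sk sl hk hl.
1-4: by lia.
by move=> [|[|[|[|i]]]] //= _; lia.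
Qed.

Lemma isolated_q2 (n : nat) : (3 < n)%N ->
  isolated 2 n (digits2 0 1 1 0) (digits2 2 3 1 0).
Proof.
move=> n_gt3; apply: isolated_head; try lia.
- by rewrite sum_digits2; lia.
- by rewrite sum_digits2; lia.
- by move=> [|[|[|[|i]]]].
move=> c k l cS sk sl.
have := cS 0%N isT; have := cS 1%N isT; have := cS 2%N isT; have := cS 3%N isT.
rewrite /digits2 /= => E3 E2 E1 E0 hkl.
have [c0 c1 c2 c3] : [/\ c 0%N = 0, c 1%N = 0, c 2%N = 0 & c 3%N = 0].
  by case: hkl => [[_ c4]|[_ [hk hl]]]; [|rewrite /pos_part in hk hl]; split; lia.
by move=> [|[|[|[|i]]]] //= _; lia.
Qed.

Lemma isolated_q3n4 : isolated 3 4 (digits2 0 2 1 1) (digits2 1 3 1 1).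
Proof.
apply: isolated_head; try lia.
- by rewrite sum_digits2; lia.
- by rewrite sum_digits2; lia.
- by move=> [|[|[|[|i]]]].
move=> c k l cS sk sl [[_ c4]|]; last lia.
have := cS 0%N isT; have := cS 1%N isT; have := cS 2%N isT; have := cS 3%N isT.
rewrite /digits2 /= c4 => E3 E2 E1 E0.
by move=> [|[|[|[|i]]]] //= _; lia.
Qed.

Lemma sum_expf_div (L : finFieldType) (i j : nat) :
  \sum_(x : L | x != 0) x ^+ i / x ^+ j != 0 -> i = j %[mod #|L|.-1].
Proof.
set S := \sum_(_ | _) _ => S_neq0.
have L_gt1 : (1 < #|L|)%N := finNzRing_gt1 L.
have pow_eq (y : L) : y != 0 -> y ^+ i = y ^+ j.
  move=> y_neq0; apply: (mulIf (invr_neq0 (expf_neq0 j y_neq0))).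
  rewrite divff ?expf_neq0 //; apply: (mulIf S_neq0); rewrite mul1r.
  rewrite {2}/S (reindex_inj (mulfI y_neq0)) /= mulr_sumr.
  apply: eq_big => [x|x x_neq0]; first by rewrite mulf_eq0 negb_or y_neq0.
  by rewrite !exprMn invfM mulrACA.
have expQ (y : L) : y != 0 -> y ^+ #|L|.-1 = 1.
  move=> y_neq0; apply: (mulIf y_neq0); rewrite mul1r -exprSr prednK ?expf_card //; lia.
pose r := ((i + #|L|.-2 * j) %% #|L|.-1)%N.
have pow_r (y : L) : y != 0 -> y ^+ r = 1.
  move=> y_neq0; rewrite expr_mod ?expQ // exprD pow_eq // -exprD.
  have -> : (j + #|L|.-2 * j = #|L|.-1 * j)%N by nia.
  by rewrite exprM expQ // expr1n.
have r_eq0 : r = 0%N.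
  apply/eqP; rewrite -leqn0 leqNgt; apply/negP => r_gt0.
  pose s := enum [pred y : L | y != 0].
  have/(max_unity_roots r_gt0) : all r.-unity_root s.
    by apply/allP => y; rewrite mem_enum => /pow_r y_r; rewrite unity_rootE y_r.
  rewrite enum_uniq -cardE => /(_ isT).
  have -> : #|[pred y : L | y != 0]| = #|L|.-1.
    by have := cardC1 (0 : L); rewrite -(eq_card (A := predC1 (0 : L))) // => x; rewrite !inE.
  by rewrite leqNgt ltn_pmod //; lia.
have : (i + #|L|.-2 * j + j = 0 + j %[mod #|L|.-1])%N.
  by rewrite -modnDml -/r r_eq0.
rewrite add0n -addnA; have -> : (#|L|.-2 * j + j = #|L|.-1 * j)%N by nia.
by rewrite mulnC addnC modnMDl.
Qed.

Lemma sum_expf_div1 (L : finFieldType) (i : nat) :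
  \sum_(x : L | x != 0) x ^+ i / x ^+ i = -1.
Proof.
rewrite (eq_bigr (fun=> 1)); last by move=> x x_neq0; rewrite divff ?expf_neq0.
have L0 : #|L|%:R = 0 :> L.
  have : \sum_(x : L) (x + 1) = \sum_(x : L) x.
    by rewrite [RHS](reindex_inj (addIr (1 : L))).
  by rewrite big_split /= sumr_const => /eqP; rewrite -subr_eq0 addrAC subrr add0r => /eqP.
have : \sum_(x : L) (1 : L) = 0 by rewrite sumr_const; apply: L0.
by rewrite (bigD1 0) //= addrC => /eqP; rewrite addr_eq0 => /eqP.
Qed.

Lemma coef_1addXn (R : comNzRingType) (n j : nat) :
  ((1 + 'X) ^+ n : {poly R})`_j = ('C(n, j))%:R.
Proof.
rewrite exprDn (eq_bigr (fun i : 'I_n.+1 => ('C(n, i))%:R *: 'X^i)) => [|i _].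
  rewrite -(poly_def _ (fun i => ('C(n, i))%:R)) coef_poly ltnS.
  by case: leqP => // /bin_small ->.
by rewrite expr1n mul1r scaler_nat.
Qed.

Lemma bin_pred_pchar (R : comNzRingType) (q j : nat) :
  [pchar R].-nat q -> (j < q)%N -> ('C(q.-1, j))%:R = (-1) ^+ j :> R.
Proof.
move=> q_pchar; elim: j => [|j IHj] j_lt; first by rewrite bin0.
have q_pcharX : [pchar {poly R}].-nat q by rewrite (eq_pnat _ (@pchar_poly R)).
have : ('C(q, j.+1))%:R = 0 :> R.
  rewrite -coef_1addXn exprDn_pchar // expr1n coefD coefXn coef1.
  by rewrite (ltn_eqF j_lt) addr0.
have -> : 'C(q, j.+1) = ('C(q.-1, j.+1) + 'C(q.-1, j))%N by rewrite -binS prednK //; lia.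
by rewrite natrD IHj ?exprS 1?ltnW // => /eqP; rewrite addr_eq0 mulN1r => /eqP.
Qed.

(* [f] picks one summand out of each factor of
   [(x + x ^ q + ... + x ^ (q ^ (n-1)) - a) ^ m]; the index [n] stands for [- a]. *)
Definition digit_count (m n : nat) (f : {ffun 'I_m -> 'I_n.+1}) (i : nat) : nat :=
  #|[set j | f j == i :> nat]|.

Definition digit_value (q m n : nat) (f : {ffun 'I_m -> 'I_n.+1}) : nat :=
  \sum_j (if f j < n then q ^ f j else 0)%N.

Lemma sum_digit_count (m n : nat) (f : {ffun 'I_m -> 'I_n.+1}) :
  (\sum_(i < n.+1) digit_count f i = m)%N.
Proof.
rewrite -[RHS]card_ord -sum1_card (partition_big f xpredT) //=.
apply: eq_bigr => i _; rewrite /digit_count -sum1_card.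
by apply: eq_bigl => j; rewrite inE.
Qed.

Lemma digit_valueE (q m n : nat) (f : {ffun 'I_m -> 'I_n.+1}) :
  (digit_value q f = \sum_(i < n) digit_count f i * q ^ i)%N.
Proof.
rewrite /digit_value (partition_big f xpredT) //= big_ord_recr /= [X in (_ + X)%N]big1 ?addn0.
  apply: eq_bigr => i _; rewrite (eq_bigr (fun=> (q ^ i)%N)) => [|j /eqP->].
    rewrite sum_nat_const; congr (_ * _)%N; apply: eq_card => j.
    by rewrite inE.
  by rewrite /= ltn_ord.
by move=> j /eqP->; rewrite /= ltnn.
Qed.

Definition digit_coef (L : comNzRingType) (m n : nat) (a : L) (f : {ffun 'I_m -> 'I_n.+1}) : L :=
  (f == [ffun=> ord_max])%:R - \prod_j (if (f j < n)%N then 1 else - a).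

Lemma expand_indicator (L : comNzRingType) (q m n : nat) (a x : L) :
  1 - (\sum_(i < n) x ^+ (q ^ i) - a) ^+ m
  = \sum_(f : {ffun 'I_m -> 'I_n.+1}) digit_coef a f * x ^+ digit_value q f.
Proof.
pose w (i : 'I_n.+1) := (if (i < n)%N then 1 else - a) * x ^+ (if i < n then q ^ i else 0)%N.
have -> : \sum_(i < n) x ^+ (q ^ i) - a = \sum_i w i.
  rewrite big_ord_recr /= /w ltnn expr0 mulr1; congr (_ + _).
  by apply: eq_bigr => i _; rewrite /= ltn_ord mul1r.
rewrite -[m in LHS]card_ord -prodr_const bigA_distr_bigA /=.
under [RHS]eq_bigr => f _ do rewrite /digit_coef mulrBl.
rewrite sumrB; congr (_ - _).
  rewrite (bigD1 [ffun=> ord_max]) //= eqxx mul1r big1 => [|f /negPf->]; last by rewrite mul0r.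
  rewrite /digit_value big1 ?expr0 ?addr0 // => j _.
  by rewrite ffunE /= ltnn.
apply: eq_bigr => f _; rewrite /w big_split /=; congr (_ * _).
by rewrite /digit_value expr_sum.
Qed.

Definition digit_class (m n : nat) (A : nat -> nat) : {set {ffun 'I_m -> 'I_n.+1}} :=
  [set f | [forall i : 'I_n, digit_count f i == A i]].

Lemma digit_classP (m n : nat) (A : nat -> nat) (f : {ffun 'I_m -> 'I_n.+1}) :
  reflect (forall i, (i < n)%N -> digit_count f i = A i) (f \in digit_class m n A).
Proof.
rewrite inE; apply: (iffP forallP) => [fA i i_lt|fA i]; last by rewrite fA.
exact/eqP/(fA (Ordinal i_lt)).
Qed.

Lemma digit_value_class (q m n : nat) (A : nat -> nat) (f : {ffun 'I_m -> 'I_n.+1}) :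
  f \in digit_class m n A -> (digit_value q f = \sum_(i < n) A i * q ^ i)%N.
Proof. by move/digit_classP => fA; rewrite digit_valueE; apply: eq_bigr => i _; rewrite fA. Qed.

Lemma digit_coef_class (L : comNzRingType) (m n : nat) (A : nat -> nat) (a : L)
    (f : {ffun 'I_m -> 'I_n.+1}) :
  (0 < m)%N -> (\sum_(i < n) A i = m)%N -> f \in digit_class m n A -> digit_coef a f = -1.
Proof.
move=> m_gt0 sumA /digit_classP fA.
have count0 : digit_count f n = 0%N.
  have := sum_digit_count f; rewrite big_ord_recr /=.
  rewrite (eq_bigr (fun i : 'I_n => A i)) => [|i _]; last exact/fA/ltn_ord.
  by rewrite sumA => /eqP; rewrite -[X in _ == X]addn0 eqn_add2l => /eqP.
have f_lt j : (f j < n)%N.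
  rewrite ltn_neqAle -ltnS ltn_ord andbT; apply/negP => /eqP fj.
  by move/eqP: count0; rewrite cards_eq0 => /eqP/setP/(_ j); rewrite !inE fj eqxx.
rewrite /digit_coef big1 => [|j _]; last by rewrite f_lt.
case: eqP => [f_max|_]; last by rewrite sub0r.
by have := f_lt (Ordinal m_gt0); rewrite f_max ffunE /= ltnn.
Qed.

Lemma card_digit_class2 (m n r s u v : nat) : (r < n)%N -> (s < n)%N -> r != s ->
  (u + v = m)%N -> #|digit_class m n (digits2 r s u v)| = 'C(m, u).
Proof.
move=> r_lt s_lt rs uv.
pose phi (X : {set 'I_m}) : {ffun 'I_m -> 'I_n.+1} :=
  [ffun j => if j \in X then inord r else inord s].
have phiE X j : phi X j = (if j \in X then r else s) :> nat.
  by rewrite ffunE; case: ifP; rewrite inordK // ltnW.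
have phi_inj : injective phi.
  move=> X Y eXY; apply/setP => j; have := congr1 val (congr1 (fun f : {ffun _ -> _} => f j) eXY).
  rewrite /= !phiE; case: (j \in X); case: (j \in Y) => //= /eqP; rewrite ?(negPf rs) //.
  by rewrite eq_sym (negPf rs).
rewrite -[m in RHS]card_ord -card_draws -(card_imset _ phi_inj).
apply: eq_card => f; apply/digit_classP/imsetP => [fA|[X]].
  exists [set j | f j == r :> nat].
    by rewrite inE -/(digit_count f r) fA // /digits2 eqxx (negPf rs) addn0.
  have card_rs : #|[set j | f j == r :> nat] :|: [set j | f j == s :> nat]| = m.
    rewrite cardsU -/(digit_count f r) -/(digit_count f s) !fA // /digits2 !eqxx.
    rewrite (negPf rs) eq_sym (negPf rs) addn0 add0n uv.
    have -> : [set j | f j == r :> nat] :&: [set j | f j == s :> nat] = set0.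
      by apply/setP => j; rewrite !inE; apply/andP => -[/eqP-> /eqP/(elimN eqP rs)].
    by rewrite cards0 subn0.
  have/setP full : [set j | f j == r :> nat] :|: [set j | f j == s :> nat] = setT.
    by apply/eqP; rewrite eqEcard subsetT cardsT card_ord card_rs /=.
  apply/ffunP => j; apply: val_inj; rewrite /= phiE inE.
  by have := full j; rewrite !inE; case: eqP => //= _ /eqP.
rewrite inE => /eqP cardX -> i i_lt; rewrite /digit_count /digits2.
have [->|ir] := eqVneq i r.
  rewrite (negPf rs) addn0 -cardX; apply: eq_card => j; rewrite inE phiE.
  by case: (j \in X); rewrite ?eqxx // eq_sym (negPf rs).
have [->|is_] := eqVneq i s.
  transitivity #|~: X|; last by rewrite cardsCs setCK card_ord cardX; lia.
  apply: eq_card => j; rewrite !inE phiE.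
  by case: (j \in X); rewrite ?eqxx // (negPf rs).
apply/eqP; rewrite cards_eq0; apply/eqP/setP => j; rewrite !inE phiE.
by case: (j \in X); rewrite eq_sym ?(negPf ir) ?(negPf is_).
Qed.

Lemma frobenius_trace (L : finFieldType) (q n : nat) (a x : L) :
  #|L| = (q ^ n)%N -> [pchar L].-nat q -> (0 < n)%N -> a ^+ q = a ->
  let u := \sum_(i < n) x ^+ (q ^ i) - a in u ^+ q = u.
Proof.
move=> cardL q_pchar n_gt0 aq /=.
have q_gt0 : (0 < q)%N by case/andP: q_pchar.
have frobN (y : L) : (- y) ^+ q = - y ^+ q.
  by apply/eqP; rewrite -addr_eq0 -exprDn_pchar // addNr expr0n gtn_eqF.
rewrite exprDn_pchar // frobN aq; congr (_ - _).
rewrite (big_morph (fun y : L => y ^+ q) (fun y z => exprDn_pchar y z q_pchar) (_ : 0 ^+ q = 0)).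
  case: n n_gt0 cardL => // n _ cardL; rewrite big_ord_recr big_ord_recl addrC /=.
  rewrite -exprM mulnC -expnS -cardL expf_card expr1; congr (_ + _).
  by apply: eq_bigr => i _; rewrite -exprM -expnSr.
by rewrite expr0n gtn_eqF.
Qed.

Lemma eq0_of_indicator (L : fieldType) (q : nat) (u : L) : (0 < q)%N ->
  u ^+ q = u -> 1 - u ^+ q.-1 != 0 -> u = 0.
Proof.
move=> q_gt0 uq; apply: contraNeq => u_neq0; rewrite subr_eq0; apply/eqP.
by apply: (mulfI u_neq0); rewrite mulr1 -exprS prednK.
Qed.

Lemma isolated_trace (L : finFieldType) (q n : nat) (A B : nat -> nat) (alpha a b : L) :
  #|L| = (q ^ n)%N -> [pchar L].-nat q -> (1 < q)%N -> (0 < n)%N ->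
  alpha != 0 -> a ^+ q = a -> b ^+ q = b -> isolated q n A B ->
  (\sum_(i < n) A i = q.-1)%N -> (\sum_(i < n) B i = q.-1)%N ->
  #|digit_class q.-1 n A|%:R != 0 :> L -> #|digit_class q.-1 n B|%:R != 0 :> L ->
  exists x : L, [/\ x != 0, \sum_(i < n) x ^+ (q ^ i) = a
                 & \sum_(i < n) (alpha / x) ^+ (q ^ i) = b].
Proof.
move=> cardL q_pchar q_gt1 n_gt0 alpha_neq0 aq bq isoAB sumA sumB cardA cardB.
pose fT := {ffun 'I_q.-1 -> 'I_n.+1}.
pose eA := (\sum_(i < n) A i * q ^ i)%N; pose eB := (\sum_(i < n) B i * q ^ i)%N.
pose ind c (x : L) := 1 - (\sum_(i < n) x ^+ (q ^ i) - c) ^+ q.-1.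
pose T := \sum_(x : L | x != 0) x ^+ eB / x ^+ eA * (ind a x * ind b (alpha / x)).
have TE : T = \sum_(f : fT) \sum_(g : fT) digit_coef a f * digit_coef b g * alpha ^+ digit_value q g *
    \sum_(x : L | x != 0) x ^+ (digit_value q f + eB) / x ^+ (eA + digit_value q g).
  transitivity (\sum_(x : L | x != 0) \sum_(f : fT) \sum_(g : fT)
      digit_coef a f * digit_coef b g * alpha ^+ digit_value q g *
      (x ^+ (digit_value q f + eB) / x ^+ (eA + digit_value q g))).
    apply: eq_bigr => x x_neq0; rewrite /ind !(expand_indicator q q.-1 n).
    rewrite big_distrlr mulr_sumr /=; apply: eq_bigr => f _; rewrite mulr_sumr.
    apply: eq_bigr => g _; rewrite exprMn exprVn !exprD invfM; ring.
  rewrite exchange_big; apply: eq_bigr => f _; rewrite exchange_big.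
  by apply: eq_bigr => g _; rewrite mulr_sumr.
have T_neq0 : T != 0.
  suff -> : T = - alpha ^+ eB * #|digit_class q.-1 n A|%:R * #|digit_class q.-1 n B|%:R.
    by rewrite !mulf_neq0 // oppr_eq0 expf_neq0.
  have q1_gt0 : (0 < q.-1)%N by lia.
  have sum_le m (f : {ffun 'I_m -> 'I_n.+1}) : (\sum_(i < n) digit_count f i <= m)%N.
    by rewrite -[leqRHS](sum_digit_count f) big_ord_recr leq_addr.
  have far (f g : fT) : (f \in digit_class q.-1 n A) && (g \in digit_class q.-1 n B) = false ->
      \sum_(x : L | x != 0) x ^+ (digit_value q f + eB) / x ^+ (eA + digit_value q g) = 0.
    move=> /negbT; apply: contraNeq => /sum_expf_div; rewrite cardL !digit_valueE.
    move=> /(isoAB _ _ (sum_le _ f) (sum_le _ g)) fgAB.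
    by apply/andP; split; apply/digit_classP => i /fgAB[].
  rewrite TE (bigID (mem (digit_class q.-1 n A))) /= [X in _ + X]big1 ?addr0; last first.
    by move=> f /negPf fA; apply: big1 => g _; rewrite far ?mulr0 // fA.
  rewrite (eq_bigr (fun=> - alpha ^+ eB * #|digit_class q.-1 n B|%:R)) => [|f fA].
    by rewrite sumr_const -[LHS]mulr_natr mulrAC.
  rewrite (bigID (mem (digit_class q.-1 n B))) /= [X in _ + X]big1 ?addr0; last first.
    by move=> g /negPf gB; rewrite far ?mulr0 // gB andbF.
  rewrite (eq_bigr (fun=> - alpha ^+ eB)) => [|g gB].
    by rewrite sumr_const -[LHS]mulr_natr.
  rewrite !(digit_value_class q fA) !(digit_value_class q gB) sum_expf_div1.
  by rewrite (digit_coef_class a q1_gt0 sumA fA) (digit_coef_class b q1_gt0 sumB gB) mulrNN !mul1r mulrN1.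
have [x /and3P[x_neq0 a_neq0 b_neq0]] : exists x, [&& x != 0, ind a x != 0 & ind b (alpha / x) != 0].
  apply/existsP; apply: contraNT T_neq0 => /existsPn no_x; apply/eqP.
  apply: big1 => x x_neq0; have := no_x x; rewrite x_neq0 /= negb_and !negbK.
  by case/orP => /eqP->; rewrite ?mul0r ?mulr0.
exists x; split=> //; apply/eqP; rewrite -subr_eq0; apply/eqP.
  by apply: (eq0_of_indicator _ _ a_neq0); [lia | apply: frobenius_trace].
by apply: (eq0_of_indicator _ _ b_neq0); [lia | apply: frobenius_trace].
Qed.

Lemma trace_product (L : finFieldType) (q n : nat) (alpha a b : L) :
  #|L| = (q ^ n)%N -> [pchar L].-nat q -> (1 < q)%N ->
  (4 < n)%N \/ n = 4%N /\ (q = 2%N \/ q = 3%N) ->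
  alpha != 0 -> a ^+ q = a -> b ^+ q = b ->
  exists x : L, [/\ x != 0, \sum_(i < n) x ^+ (q ^ i) = a
                 & \sum_(i < n) (alpha / x) ^+ (q ^ i) = b].
Proof.
move=> cardL q_pchar q_gt1 hqn alpha_neq0 aq bq.
have n_gt3 : (3 < n)%N by lia.
have main r s r' s' u v : (r < n)%N -> (s < n)%N -> (r' < n)%N -> (s' < n)%N ->
    r != s -> r' != s' -> (u + v = q.-1)%N ->
    isolated q n (digits2 r s u v) (digits2 r' s' u v) ->
    exists x : L, [/\ x != 0, \sum_(i < n) x ^+ (q ^ i) = a
                 & \sum_(i < n) (alpha / x) ^+ (q ^ i) = b].
  move=> r_lt s_lt r_lt' s_lt' rs rs' uv iso.
  have bin_neq0 : ('C(q.-1, u))%:R != 0 :> L by rewrite bin_pred_pchar ?signr_eq0 //; lia.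
  by apply: isolated_trace iso _ _ _ _ => //; rewrite ?sum_digits2 ?card_digit_class2 //; lia.
have [q2|[q3n4|[q_gt2 n_gt4]]] : q = 2%N \/ (q = 3%N /\ n = 4%N) \/ (2 < q)%N /\ (4 < n)%N by lia.
- subst q; apply: (main 0 1 2 3 1 0)%N; try lia; exact: isolated_q2.
- case: q3n4 => ? ?; subst q n; apply: (main 0 2 1 3 1 1)%N; try lia; exact: isolated_q3n4.
- apply: (main 0 2 1 3 q.-1./2 (q.-1 - q.-1./2))%N; try lia; exact: isolated_ge5.
Qed.

Theorem theorem5p1 (q n : nat) (F : finFieldType) (L : fieldExtType F)
    (cardF : #|F| = q) (dimL : \dim {:L} = n)
    (hqn : (5 <= n)%N \/ (n = 4%N /\ (q = 2%N \/ q = 3%N)))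
    (alpha : L) (alpha_neq0 : alpha != 0) (a b : F) :
  exists x y : L,
    [/\ field_trace x = a%:A, field_trace y = b%:A & alpha = x * y].
Proof.
have q_gt1 : (1 < q)%N by rewrite -cardF finNzRing_gt1.
pose L' : finFieldType := finvect_type L.
have cardL : #|L'| = (q ^ n)%N.
  by rewrite -cardF -dimL -(@card_vspace F (finvect_type L)) card_vspacef.
have q_pchar : [pchar L'].-nat q.
  have [p p_pr pcharF] := finPcharP F.
  have := abelem_pgroup (fin_ring_pchar_abelem pcharF).
  rewrite /pgroup cardsT cardF; apply: sub_in_pnat => r _ /eqP->.
  by rewrite (@pchar_lalg F L).
have alg_q (c : F) : (c%:A : L) ^+ q = c%:A by rewrite -in_algE -rmorphXn /= -cardF expf_card.
have [x [x_neq0 tr_x tr_y]] :=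
  @trace_product L' q n alpha a%:A b%:A cardL q_pchar q_gt1 hqn alpha_neq0 (alg_q a) (alg_q b).
exists x, (alpha / x : L); rewrite /field_trace cardF dimL.
split; [exact: tr_x | exact: tr_y |].
by rewrite mulrC divfK.
Qed.
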